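(* Let $U:\mathbb{R}^d\to\mathbb{R}$ be continuously differentiable and $\ell$-Lipschitz for some $\ell>0$, let $K:\mathbb{R}^d\to\mathbb{R}$ be a differentiable kinetic energy, and let $H(q,p)=U(q)+K(p)$ be a Hamiltonian on $\mathbb{R}^{2d}$ satisfying $H(q,-p)=H(q,p)$. Let $\gamma\ge 0$. Let $\varphi^{-}_t$ and $\varphi^{+}_t$ be the integral operators (flow maps) solving, for time $t$, the damped and the amplifying system, respectively, and let $\mathsf{F}:(q,p)\mapsto(q,-p)$ be the momentum-flip operator. Then $$\mathsf{F}\circ(\varphi^{+}_t)^{-1}=\varphi^{-}_t\circ\mathsf{F}\qquad\text{and}\qquad \mathsf{F}\circ(\varphi^{-}_t)^{-1}=\varphi^{+}_t\circ\mathsf{F}\qquad\text{for all }t\in\mathbb{R}.$$ In particular, for the exact repelling-attracting flow operator $\Psi_T$ and its numerical approximation $\Psi_{\epsilon,L}$, the compositions with the momentum flip, $\mathsf{F}\circ\Psi_T$ and $\mathsf{F}\circ\Psi_{\epsilon,L}$, are involutions: $$(\mathsf{F}\circ\Psi_T)\circ(\mathsf{F}\circ\Psi_T)=\mathrm{id}=(\mathsf{F}\circ\Psi_{\epsilon,L})\circ(\mathsf{F}\circ\Psi_{\epsilon,L}).$$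
   Context: Points of $\mathbb{R}^{2d}$ are written $z=(q,p)$ with $q,p\in\mathbb{R}^d$. The function $U=-\log\pi$ is the potential energy of a target density $\pi$ on $\mathbb{R}^d$. Exact flows: $\varphi^{-}_t$ (damped) and $\varphi^{+}_t$ (amplifying) are the time-$t$ flow maps on $\mathbb{R}^{2d}$ of the autonomous systems $$\dot q=\nabla K(p),\quad \dot p=-\nabla U(q)-\gamma p\quad(\text{for }\varphi^{-}),\qquad \dot q=\nabla K(p),\quad \dot p=-\nabla U(q)+\gamma p\quad(\text{for }\varphi^{+}).$$ For $T>0$, the exact repelling-attracting flow is $\Psi_T:=\varphi^{-}_{T/2}\circ\varphi^{+}_{T/2}$. Numerical scheme (conformal leapfrog, formulated for the quadratic kinetic energy $K(p)=\tfrac12 p^\top\Sigma^{-1}p$ with $\Sigma\in\mathbb{R}^{d\times d}$ symmetric positive definite): for a step size $\epsilon>0$ let $\Phi^H_\epsilon:=\xi_1\circ\xi_2\circ\xi_1$ be the leapfrog step, with $\xi_1(q,p)=(q,\,p-\tfrac{\epsilon}{2}\nabla U(q))$ and $\xi_2(q,p)=(q+\epsilon\Sigma^{-1}p,\,p)$, and let $\eta^{\pm}(q,p)=(q,\,e^{\pm\gamma\epsilon/2}p)$. One conformal leapfrog step is $\varphi^{\pm}_{[\epsilon]}:=\eta^{\pm}\circ\Phi^H_\epsilon\circ\eta^{\pm}$. For a positive integer $L$, $$\Psi_{\epsilon,L}:=\big(\varphi^{-}_{[\epsilon]}\big)^{\lfloor L/2\rfloor}\circ\big(\varphi^{+}_{[\epsilon]}\big)^{\lfloor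 L/2\rfloor},$$ where powers denote iterated composition. *)

(* Defs.v *)
From HB Require Import structures.
From mathcomp Require Import all_boot all_order all_algebra.
From mathcomp Require Import all_classical all_reals all_analysis.

Set Implicit Arguments.
Unset Strict Implicit.
Unset Printing Implicit Defensive.

Import Order.TTheory GRing.Theory Num.Theory.
Import numFieldNormedType.Exports.

Local Open Scope ring_scope.

(* A point (q, p) of R^(2d) is a pair of column vectors. *)
Notation phase R d := ('cV[R]_d * 'cV[R]_d)%type.

(* The canonical norm on 'cV[R]_d is the sup norm, hence this definition. *)
Definition euclidean_norm (R : realType) (d : nat) (x : 'cV[R]_d) : R :=
  Num.sqrt (\sum_(i < d) x i 0 ^+ 2).

Definition euclidean_lipschitz (R : realType) (d : nat) (ell : R)
    (f : 'cV[R]_d -> R) : Prop :=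
  forall x y, `|f x - f y| <= ell * euclidean_norm (x - y).

Definition gradient (R : realType) (d : nat) (f : 'cV[R]_d -> R)
    (x : 'cV[R]_d) : 'cV[R]_d :=
  \col_(i < d) 'D_(delta_mx i 0) f x.

Definition continuously_differentiable (R : realType) (d : nat)
    (f : 'cV[R]_d -> R) : Prop :=
  (forall x, differentiable f x) /\ continuous (gradient f).

Definition hamiltonian (R : realType) (d : nat) (U K : 'cV[R]_d -> R)
    (z : phase R d) : R :=
  U z.1 + K z.2.

Definition momentum_flip (R : realType) (d : nat) (z : phase R d) :
    phase R d :=
  (z.1, - z.2).

(* The coefficient c is - gamma for the damped system and + gamma for the
   amplifying one. *)
Definition conformal_field (R : realType) (d : nat) (U K : 'cV[R]_d -> R)
    (c : R) (z : phase R d) : phase R d :=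
  (gradient K z.2, - gradient U z.1 + c *: z.2).

Definition is_solution (R : realType) (d : nat)
    (V : phase R d -> phase R d) (y : R -> phase R d) : Prop :=
  forall t : R, is_derive t 1 y (V (y t)).

(* phi t z is the value at time t of the solution of the autonomous system
   z' = V z starting from z at time 0.  "The" solution means that it is unique:
   for a field that is merely continuous, the initial value problem alone need
   not determine a flow map. *)
Definition is_flow (R : realType) (d : nat)
    (V : phase R d -> phase R d) (phi : R -> phase R d -> phase R d) : Prop :=
  forall z : phase R d,
    [/\ phi 0 z = z,
        is_solution V (phi ^~ z) &
        forall y : R -> phase R d,
          is_solution V y -> y 0 = z -> forall t, y t = phi t z].

Definition is_inverse (T : Type) (f g : T -> T) : Prop :=
  cancel f g /\ cancel g f.

Definition exact_repelling_attracting (R : realType) (d : nat)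
    (phi_damped phi_amplifying : R -> phase R d -> phase R d) (T : R) :
    phase R d -> phase R d :=
  phi_damped (T / 2) \o phi_amplifying (T / 2).

Definition sym_pos_def (R : realType) (d : nat) (S : 'M[R]_d) : Prop :=
  S^T = S /\ (forall x : 'cV[R]_d, x != 0 -> 0 < (x^T *m S *m x) 0 0).

Definition quadratic_kinetic (R : realType) (d : nat) (Sigma : 'M[R]_d)
    (p : 'cV[R]_d) : R :=
  2^-1 * (p^T *m invmx Sigma *m p) 0 0.

Definition leapfrog_kick (R : realType) (d : nat) (U : 'cV[R]_d -> R)
    (eps : R) (z : phase R d) : phase R d :=
  (z.1, z.2 - (eps / 2) *: gradient U z.1).

Definition leapfrog_drift (R : realType) (d : nat) (Sigma : 'M[R]_d)
    (eps : R) (z : phase R d) : phase R d :=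
  (z.1 + eps *: (invmx Sigma *m z.2), z.2).

Definition leapfrog (R : realType) (d : nat) (U : 'cV[R]_d -> R)
    (Sigma : 'M[R]_d) (eps : R) : phase R d -> phase R d :=
  leapfrog_kick U eps \o leapfrog_drift Sigma eps \o leapfrog_kick U eps.

Definition momentum_scaling (R : realType) (d : nat) (c eps : R)
    (z : phase R d) : phase R d :=
  (z.1, expR (c * eps / 2) *: z.2).

Definition conformal_leapfrog (R : realType) (d : nat) (U : 'cV[R]_d -> R)
    (Sigma : 'M[R]_d) (c eps : R) : phase R d -> phase R d :=
  momentum_scaling c eps \o leapfrog U Sigma eps \o momentum_scaling c eps.

Definition numerical_repelling_attracting (R : realType) (d : nat)
    (U : 'cV[R]_d -> R) (Sigma : 'M[R]_d) (gamma eps : R) (L : nat) :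
    phase R d -> phase R d :=
  iter L./2 (conformal_leapfrog U Sigma (- gamma) eps) \o
  iter L./2 (conformal_leapfrog U Sigma gamma eps).

(* Main.v *)
Require Import Defs.
From HB Require Import structures.
From mathcomp Require Import all_boot all_order all_algebra.
From mathcomp Require Import all_classical all_reals all_analysis.

Set Implicit Arguments.
Unset Strict Implicit.
Unset Printing Implicit Defensive.

Import Order.TTheory GRing.Theory Num.Theory.
Import numFieldNormedType.Exports.

Local Open Scope ring_scope.

(** [K] is even, so its gradient is odd; hence flipping the momentum of a
    time-reversed solution of the field with coefficient [c] gives a solution of
    the field with coefficient [- c].  Uniqueness then yields
    F o phi_c(-t) = phi_(-c)(t) o F, while phi_c(-t) inverts phi_c(t) by the
    group law.  Each factor of the numerical scheme satisfies the same kind of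
    reversal identity f o F o g = F, which composes and iterates.  Both
    involutions follow, since f o F o g = F = g o F o f and F o F = id give
    F o (g o f) o F o (g o f) = id. *)

(** Since [h = h *: 1], a differential on the line is fixed by its value at [1]. This makes the
    chain rule for [is_diff] available for curves. *)
Lemma is_derive1_diff (R : realType) (V : normedModType R) (f : R -> V)
    (t : R) (df : V) :
  is_derive t 1 f df <-> is_diff t f ( *:%R ^~ df).
Proof.
split=> [[/derivable1_diffP fD <-]|[fD fE]].
  apply: DiffDef => //; apply/funext => h.
  by rewrite deriveE// -linearZ/= [h *: 1]mulr1.
apply: DeriveDef; first exact/derivable1_diffP.
by rewrite deriveE// fE scale1r.
Qed.

(** Serves both time shift ([a = 1]) and time reversal ([a = -1], [b = 0]). *)
Lemma is_derive1_affine (R : realType) (V : normedModType R) (f : R -> V)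
    (a b t : R) (df : V) :
  is_derive (a * t + b) 1 f df ->
  is_derive t 1 (fun s => f (a * s + b)) (a *: df).
Proof.
move=> /is_derive1_diff fD; apply/is_derive1_diff.
have aD : is_diff t (fun s : R => a * s + b) (fun h => a * h).
  have -> : (fun h => a * h) = *%R a + cst 0 :> (R -> R).
    by apply/funext => h /=; rewrite fctE addr0.
  exact: (is_diffD (is_diff_scaler a t) (is_diff_cst b t)).
have -> : *:%R^~ (a *: df) = *:%R^~ df \o *%R a :> (R -> V).
  by apply/funext => h /=; rewrite scalerA mulrC.
exact: (is_diff_comp aD fD).
Qed.

Lemma is_derive1_linear (R : realType) (V W : normedModType R)
    (L : {linear V -> W}) (f : R -> V) (t : R) (df : V) :
  continuous L -> is_derive t 1 f df -> is_derive t 1 (L \o f) (L df).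
Proof.
move=> Lc /is_derive1_diff fD; apply/is_derive1_diff.
have LD : is_diff (f t) L L.
  apply: DiffDef; first exact: (linear_differentiable (f t) Lc).
  exact: (diff_lin (f t) Lc).
have -> : *:%R^~ (L df) = L \o *:%R^~ df :> (R -> W).
  by apply/funext => h /=; rewrite linearZ.
exact: is_diff_comp.
Qed.

Lemma gradient_even (R : realType) (d : nat) (f : 'cV[R]_d -> R)
    (x : 'cV[R]_d) :
  (forall y, f (- y) = f y) -> differentiable f x ->
  gradient f (- x) = - gradient f x.
Proof.
move=> feven fD; apply/matrixP => i j; rewrite !mxE.
set v := delta_mx i 0.
(* Differentiability makes the derivative linear in its direction, so the sign moves onto [v]; by
   evenness the difference quotients at [- x] along [v] and at [x] along [- v] then coincide. *)
rewrite [RHS](_ : _ = 'D_(- v) f x); last by rewrite !deriveE// linearN.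
rewrite /derive; under eq_fun => h.
  by rewrite /= feven -feven opprD opprK -scalerN; over.
by [].
Qed.

Lemma momentum_flipK (R : realType) (d : nat) :
  involutive (@momentum_flip R d).
Proof. by move=> [q p]; rewrite /momentum_flip/= opprK. Qed.

Lemma momentum_flip_is_linear (R : realType) (d : nat) :
  linear (@momentum_flip R d).
Proof.
move=> a [q p] [q' p']; congr pair => /=.
by rewrite opprD scalerN.
Qed.

HB.instance Definition _ (R : realType) (d : nat) :=
  GRing.isLinear.Build R (phase R d) (phase R d) *:%R (@momentum_flip R d)
    (@momentum_flip_is_linear R d).

Lemma continuous_momentum_flip (R : realType) (d : nat) :
  continuous (@momentum_flip R d).
Proof.
move=> z.
have qc : (w.1 @[w --> z] --> z.1)%classic by exact: cvg_fst.
have pc : (- w.2 @[w --> z] --> - z.2)%classic by apply: cvgN; exact: cvg_snd.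
exact: (cvg_pair qc pc).
Qed.

Lemma is_solution_shift (R : realType) (d : nat)
    (V : phase R d -> phase R d) (y : R -> phase R d) (b : R) :
  is_solution V y -> is_solution V (fun t => y (t + b)).
Proof.
move=> yV t; have := @is_derive1_affine _ _ y 1 b t (V (y (t + b))).
rewrite mul1r scale1r => /(_ (yV _)).
by under [fun s => y (1 * s + b)]funext do rewrite mul1r.
Qed.

(** Reversing time negates the velocity, and the flip negates its momentum part once more. The
    position part is left with a sign, absorbed by oddness of [gradient K]; the momentum part is
    unchanged, and its term [c *: p] equals [(- c) *: (- p)]. *)
Lemma is_solution_reversal (R : realType) (d : nat) (U K : 'cV[R]_d -> R)
    (c : R) (y : R -> phase R d) :
  (forall p, gradient K (- p) = - gradient K p) ->
  is_solution (conformal_field U K c) y ->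
  is_solution (conformal_field U K (- c)) (fun t => momentum_flip (y (- t))).
Proof.
move=> Kodd yV t.
have := @is_derive1_affine _ _ y (-1) 0 t (conformal_field U K c (y (- t))).
rewrite mulN1r addr0 scaleN1r => /(_ (yV _)).
under [fun s => y (-1 * s + 0)]funext do rewrite mulN1r addr0.
move=> /(is_derive1_linear (@continuous_momentum_flip R d)).
congr (is_derive t 1 _ _).
rewrite /conformal_field /momentum_flip /=; congr pair; first by rewrite Kodd.
by rewrite opprK scalerN scaleNr opprK.
Qed.

(** As functions of [s], both sides solve the same autonomous system from [phi t z], so uniqueness
    identifies them. *)
Lemma flow_add (R : realType) (d : nat) (V : phase R d -> phase R d)
    (phi : R -> phase R d -> phase R d) (s t : R) (z : phase R d) :
  is_flow V phi -> phi s (phi t z) = phi (s + t) z.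
Proof.
move=> phiV; have [_ _ phi_uniq] := phiV (phi t z).
have [_ phi_sol _] := phiV z.
rewrite -(phi_uniq (fun r => phi (r + t) z)) ?add0r//.
exact: is_solution_shift phi_sol.
Qed.

Lemma flow_inverse (R : realType) (d : nat) (V : phase R d -> phase R d)
    (phi : R -> phase R d -> phase R d) (t : R) :
  is_flow V phi -> is_inverse (phi t) (phi (- t)).
Proof.
move=> phiV; split=> z; have [phi0 _ _] := phiV z.
  by rewrite (flow_add _ _ _ phiV) addNr.
by rewrite (flow_add _ _ _ phiV) addrN.
Qed.

Lemma flow_reversal (R : realType) (d : nat) (U K : 'cV[R]_d -> R) (c : R)
    (phi psi : R -> phase R d -> phase R d) (t : R) (z : phase R d) :
  (forall p, gradient K (- p) = - gradient K p) ->
  is_flow (conformal_field U K c) phi ->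
  is_flow (conformal_field U K (- c)) psi ->
  momentum_flip (phi (- t) z) = psi t (momentum_flip z).
Proof.
move=> Kodd phiV psiV; have [phi0 phi_sol _] := phiV z.
have [_ _ psi_uniq] := psiV (momentum_flip z).
apply: (psi_uniq (fun r => momentum_flip (phi (- r) z))).
  exact: is_solution_reversal phi_sol.
by rewrite oppr0 phi0.
Qed.

Lemma involutive_of_reversal (T : Type) (F f g : T -> T) :
  involutive F -> (forall z, f (F (g z)) = F z) ->
  (forall z, g (F (f z)) = F z) -> involutive (F \o (g \o f)).
Proof. by move=> FK fg gf z /=; rewrite fg gf FK. Qed.

Lemma iter_reversal (T : Type) (F f g : T -> T) (n : nat) (z : T) :
  (forall w, f (F (g w)) = F w) -> iter n f (F (iter n g z)) = F z.
(* The cancellation runs from the inside: the innermost [f] meets the outermost [g] across [F]. *)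
Proof. by move=> fg; elim: n => //= n IHn; rewrite -iterS iterSr fg. Qed.

(** The word kick, drift, kick is a palindrome, so the second leapfrog undoes the factors of the
    first in the right order. *)
Lemma leapfrog_reversal (R : realType) (d : nat) (U : 'cV[R]_d -> R)
    (Sigma : 'M[R]_d) (eps : R) (z : phase R d) :
  leapfrog U Sigma eps (momentum_flip (leapfrog U Sigma eps z)) =
  momentum_flip z.
Proof.
have kick_rev w : leapfrog_kick U eps (momentum_flip (leapfrog_kick U eps w)) =
    momentum_flip w.
  by rewrite /leapfrog_kick /momentum_flip /= opprB addrAC subrr add0r.
have drift_rev w : leapfrog_drift Sigma eps
    (momentum_flip (leapfrog_drift Sigma eps w)) = momentum_flip w.
  by rewrite /leapfrog_drift /momentum_flip /= mulmxN scalerN addrK.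
by rewrite /leapfrog /= kick_rev drift_rev kick_rev.
Qed.

Lemma momentum_scaling_reversal (R : realType) (d : nat) (c eps : R)
    (z : phase R d) :
  momentum_scaling (- c) eps (momentum_flip (momentum_scaling c eps z)) =
  momentum_flip z.
Proof.
rewrite /momentum_scaling /momentum_flip /= scalerN scalerA -expRD.
by rewrite !mulNr addNr expR0 scale1r.
Qed.

Lemma conformal_leapfrog_reversal (R : realType) (d : nat)
    (U : 'cV[R]_d -> R) (Sigma : 'M[R]_d) (c eps : R) (z : phase R d) :
  conformal_leapfrog U Sigma (- c) eps
    (momentum_flip (conformal_leapfrog U Sigma c eps z)) = momentum_flip z.
Proof.
rewrite /conformal_leapfrog /= momentum_scaling_reversal leapfrog_reversal.
exact: momentum_scaling_reversal.
Qed.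

Theorem mainTheorem1 (R : realType) (d : nat) (U K : 'cV[R]_d -> R)
    (ell gamma : R)
    (ell_gt0 : 0 < ell)
    (U_C1 : continuously_differentiable U)
    (U_lip : euclidean_lipschitz ell U)
    (K_diff : forall p : 'cV[R]_d, differentiable K p)
    (H_even : forall q p : 'cV[R]_d,
      hamiltonian U K (q, - p) = hamiltonian U K (q, p))
    (gamma_ge0 : 0 <= gamma) :
  (forall phi_damped phi_amplifying : R -> phase R d -> phase R d,
    is_flow (conformal_field U K (- gamma)) phi_damped ->
    is_flow (conformal_field U K gamma) phi_amplifying ->
    [/\ forall t : R,
          exists2 g : phase R d -> phase R d,
            is_inverse (phi_amplifying t) g &
            @momentum_flip R d \o g = phi_damped t \o @momentum_flip R d,
        forall t : R,
          exists2 g : phase R d -> phase R d,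
            is_inverse (phi_damped t) g &
            @momentum_flip R d \o g = phi_amplifying t \o @momentum_flip R d &
        forall T : R, 0 < T ->
          involutive (@momentum_flip R d \o
            exact_repelling_attracting phi_damped phi_amplifying T)])
  /\
  (forall (Sigma : 'M[R]_d) (eps : R) (L : nat),
    sym_pos_def Sigma ->
    (forall p : 'cV[R]_d, K p = quadratic_kinetic Sigma p) ->
    0 < eps -> (0 < L)%N ->
    involutive (@momentum_flip R d \o
      numerical_repelling_attracting U Sigma gamma eps L)).
Proof.
split=> [phim phip phimV phipV|Sigma eps L _ _ _ _]; last first.
  apply: involutive_of_reversal => [|z|z]; first exact: momentum_flipK.
    apply: iter_reversal => w.
    (* The reversal identity applies with [c = - gamma], once the outer [gamma] is written
       [- - gamma]. *)
    by rewrite -{1}[gamma]opprK conformal_leapfrog_reversal.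
  by apply: iter_reversal => w; exact: conformal_leapfrog_reversal.
have Kodd p : gradient K (- p) = - gradient K p.
  (* Evenness of [K] comes from that of the Hamiltonian at [q = 0], by cancelling [U 0]. *)
  by apply: gradient_even => // r; exact: addrI (H_even 0 r).
have rev_p t z : momentum_flip (phip (- t) z) = phim t (momentum_flip z).
  exact: flow_reversal phipV phimV.
have rev_m t z : momentum_flip (phim (- t) z) = phip t (momentum_flip z).
  by apply: flow_reversal phimV _; rewrite ?opprK.
split=> [t|t|T _].
- exists (phip (- t)); first exact: flow_inverse phipV.
  by apply/funext => z; exact: rev_p.
- exists (phim (- t)); first exact: flow_inverse phimV.
  by apply/funext => z; exact: rev_m.
- have [phipK _] := flow_inverse (T / 2) phipV.
  have [phimK _] := flow_inverse (T / 2) phimV.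
  apply: involutive_of_reversal => [|z|z]; first exact: momentum_flipK.
    (* Read backwards, [rev_m] turns the amplifying flow after a flip into the damped flow run
       backwards, which cancels [phim (T / 2)]. *)
    by rewrite -rev_m phimK.
  by rewrite -rev_p phipK.
Qed.
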